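(* Let $X_i$, $i<2^{\omega}$, be Banach spaces with $w^*$-separable duals (resp. $w^*$-separable dual unit balls). Assume there exists an injective bounded linear operator (resp. a linear isometry, i.e. a linear isometric embedding) from a Banach space $Y$ into $\Big(\bigoplus_{i<2^{\omega}} X_i\Big)_{\ell_1}$. Then $Y$ has $w^*$-separable dual (resp. $w^*$-separable dual unit ball) as well.
   Context: $2^\omega$ is the cardinality of the continuum. A Banach space $X$ has $w^*$-separable dual (resp. dual unit ball) if $(X^*,w^* )$ (resp. $(B_{X^*},w^* )$, where $B_{X^*}$ is the closed unit ball of $X^*$) is a separable topological space. $\Big(\bigoplus_{i<2^{\omega}} X_i\Big)_{\ell_1}$ is the $\ell_1$-sum, i.e. families $(x_i)_i$ with $x_i\in X_i$ and norm $\sum_i\|x_i\|<\infty$. *)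

(* Defs.v *)
From HB Require Import structures.
From mathcomp Require Import all_boot all_order all_algebra.
From mathcomp Require Import all_classical all_reals all_analysis.

Set Implicit Arguments.
Unset Strict Implicit.
Unset Printing Implicit Defensive.

Import Order.TTheory GRing.Theory Num.Theory.
Import numFieldNormedType.Exports.

Local Open Scope classical_set_scope.
Local Open Scope ring_scope.

Definition separable_space (T : topologicalType) : Prop :=
  exists2 D : set T, countable D & dense D.

Section weak_star.
Context {R : realType} (X : normedModType R).

Definition dual : set (X -> R) :=
  [set f | linear (f : X -> R^o) /\ continuous f].

Definition dual_norm (f : X -> R) : \bar R :=
  ereal_sup [set (`|f x|)%:E | x in [set x : X | `|x| <= 1]].

Definition dual_unit_ball : set (X -> R) :=
  [set f | dual f /\ (dual_norm f <= 1)%E].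

(* The weak* topology is that of pointwise convergence on X; a set A of
   functionals carries the subspace topology inherited from {ptws X -> R}. *)
Definition wstar (A : set (X -> R)) : topologicalType :=
  initial_topology (fun f : A => (\val f : {ptws X -> R})).

Definition wstar_separable_dual : Prop := separable_space (wstar dual).

Definition wstar_separable_dual_unit_ball : Prop :=
  separable_space (wstar dual_unit_ball).

End weak_star.

Section l1sum.
Context {R : realType} {I : choiceType} (X : I -> normedModType R).

Record l1sum := L1sum {
  l1fun :> forall i, X i ;
  l1fun_summable : summable [set: I] (fun i => (`|l1fun i|)%:E) }.

HB.instance Definition _ := gen_eqMixin l1sum.
HB.instance Definition _ := gen_choiceMixin l1sum.

Lemma l1sum_eq (x y : l1sum) : (forall i, x i = y i) -> x = y.
Proof.
case: x y => [f fP] [g gP] /= fg.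
have {}fg : f = g by apply: functional_extensionality_dep.
by subst g; congr L1sum; exact: Prop_irrelevance.
Qed.

Definition l1norm (x : l1sum) : R := fine (\esum_(i in [set: I]) (`|x i|)%:E).

Lemma l1normE (x : l1sum) : (l1norm x)%:E = (\esum_(i in [set: I]) (`|x i|)%:E)%E.
Proof.
rewrite /l1norm fineK//; have := l1fun_summable x; rewrite summableE.
by under eq_esum do rewrite abse_EFin normr_id.
Qed.

Lemma l1_summable (f : forall i, X i) (c : R) :
  (\esum_(i in [set: I]) (`|f i|)%:E <= c%:E)%E ->
  summable [set: I] (fun i => (`|f i|)%:E).
Proof.
move=> fc; rewrite /summable; under eq_esum do rewrite abse_EFin normr_id.
by rewrite (le_lt_trans fc)// ltry.
Qed.

Lemma l1_zero_le :
  (\esum_(i in [set: I]) (`|0 : X i|)%:E <= (0 : R)%:E)%E.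
Proof. by rewrite esum1// => i _; rewrite normr0. Qed.

Lemma l1_add_le (x y : l1sum) :
  (\esum_(i in [set: I]) (`|x i + y i|)%:E <= (l1norm x + l1norm y)%:E)%E.
Proof.
rewrite EFinD !l1normE -esumD//.
by apply: le_esum => i _; rewrite -EFinD lee_fin ler_normD.
Qed.

Lemma l1_scale_le (a : R) (x : l1sum) :
  (\esum_(i in [set: I]) (`|a *: x i|)%:E <= (`|a| * l1norm x)%:E)%E.
Proof.
rewrite EFinM l1normE; apply: ge_ereal_sup => _ [F [finF FI] <-].
under eq_fsbigr do rewrite normrZ EFinM.
rewrite -ge0_mule_fsumr// lee_pmul//; first by apply: fsume_ge0.
by apply: ereal_sup_ubound; exists F.
Qed.

Lemma l1_opp_le (x : l1sum) :
  (\esum_(i in [set: I]) (`|- x i|)%:E <= (l1norm x)%:E)%E.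
Proof. by rewrite l1normE; apply: le_esum => i _; rewrite normrN. Qed.

Definition l1zero : l1sum := L1sum (l1_summable l1_zero_le).
Definition l1opp (x : l1sum) : l1sum := L1sum (l1_summable (l1_opp_le x)).
Definition l1add (x y : l1sum) : l1sum := L1sum (l1_summable (l1_add_le x y)).
Definition l1scale (a : R) (x : l1sum) : l1sum :=
  L1sum (l1_summable (l1_scale_le a x)).

Fact l1addA : associative l1add.
Proof. by move=> x y z; apply: l1sum_eq => i; exact: addrA. Qed.

Fact l1addC : commutative l1add.
Proof. by move=> x y; apply: l1sum_eq => i; exact: addrC. Qed.

Fact l1add0 : left_id l1zero l1add.
Proof. by move=> x; apply: l1sum_eq => i; exact: add0r. Qed.

Fact l1addN : left_inverse l1zero l1opp l1add.
Proof. by move=> x; apply: l1sum_eq => i; exact: addNr. Qed.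

HB.instance Definition _ :=
  GRing.isZmodule.Build l1sum l1addA l1addC l1add0 l1addN.

Fact l1scaleA (a b : R) (x : l1sum) :
  l1scale a (l1scale b x) = l1scale (a * b) x.
Proof. by apply: l1sum_eq => i; exact: scalerA. Qed.

Fact l1scale1 : left_id 1 l1scale.
Proof. by move=> x; apply: l1sum_eq => i; exact: scale1r. Qed.

Fact l1scaleDr : right_distributive l1scale +%R.
Proof. by move=> a x y; apply: l1sum_eq => i; exact: scalerDr. Qed.

Fact l1scaleDl (x : l1sum) : {morph l1scale^~ x : a b / a + b}.
Proof. by move=> a b; apply: l1sum_eq => i; exact: scalerDl. Qed.

HB.instance Definition _ := GRing.Zmodule_isLmodule.Build R l1sum
  l1scaleA l1scale1 l1scaleDr l1scaleDl.

Fact l1normD (x y : l1sum) : l1norm (x + y) <= l1norm x + l1norm y.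
Proof. by rewrite -lee_fin l1normE; exact: l1_add_le. Qed.

Fact l1normZ (a : R) (x : l1sum) : l1norm (a *: x) = `|a| * l1norm x.
Proof.
have le b (y : l1sum) : l1norm (b *: y) <= `|b| * l1norm y.
  by rewrite -lee_fin l1normE; exact: l1_scale_le.
have ge0 (y : l1sum) : 0 <= l1norm y.
  by rewrite -lee_fin l1normE; apply: esum_ge0.
apply/eqP; rewrite eq_le le/=; have [->|a0] := eqVneq a 0.
  by rewrite normr0 mul0r.
rewrite mulrC -ler_pdivlMr ?normr_gt0// mulrC -normfV.
by rewrite -[X in l1norm X <= _]scale1r -(mulVf a0) -scalerA.
Qed.

Fact l1norm_eq0 (x : l1sum) : l1norm x = 0 -> x = 0.
Proof.
move=> x0; apply: l1sum_eq => i; apply/normr0_eq0/eqP.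
rewrite eq_le normr_ge0 andbT -lee_fin -x0 l1normE.
rewrite -(@esum_set1 _ _ i (fun j => (`|x j|)%:E))//.
by apply: le_ereal_sup => _ [F [finF Fi] <-]; exists F.
Qed.

HB.instance Definition _ :=
  Lmodule_isNormed.Build R l1sum l1normD l1normZ l1norm_eq0.

End l1sum.

(* Main.v *)
(** A midpoint-convex set of functionals is weak* dense in any larger set with
    the same support function: this is the nearest-point argument on finitely
    many coordinates. The midpoint closure of a countable set is countable, so
    a countable total set of functionals on [Y] (with its natural multiples),
    resp. a countable norming one, suffices. Conversely Hahn-Banach turns weak*
    separability of the dual (resp. dual ball) of [X i] into a total (resp.
    norming) sequence [f i n] in the ball. As the index set injects into
    sequences of bits, there are countably many functions [phi : I -> nat], each
    depending on finitely many prefixes, that interpolate every prescription on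
    a finite set (Hewitt-Marczewski-Pondiczery); the functionals
    [x |-> \sum_i f i (phi i) (x i)] are then total (resp. norming) on the
    l1-sum, because a finite set of indices carries almost all the norm of [x],
    and they are pulled back to [Y]. *)
From HB Require Import structures.
Require Import Defs.
From mathcomp Require Import all_boot all_order all_algebra.
From mathcomp Require Import all_classical all_reals all_analysis.
From mathcomp Require Import ring lra.
Import Order.TTheory GRing.Theory Num.Theory.
Import numFieldNormedType.Exports.
Local Open Scope classical_set_scope.
Local Open Scope ring_scope.

Set Implicit Arguments.
Unset Strict Implicit.
Unset Printing Implicit Defensive.

(** * Norm-attaining functionals through minimal sublinear functionals *)

Section hahn_banach.
Context {R : realType} {V : normedModType R}.
Implicit Types (p q : V -> R) (x y v : V).

Definition sublinear p :=
  (forall x y, p (x + y) <= p x + p y) /\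
  (forall (a : R) x, 0 < a -> p (a *: x) <= a * p x).

Lemma sublinear0 p : sublinear p -> p 0 = 0.
Proof.
move=> [pD pZ]; have := pD 0 0; have := pZ 2^-1 0; rewrite scaler0 addr0.
by move=> /(_ ltac:(lra)); lra.
Qed.

Lemma sublinearN_ge p x : sublinear p -> - p (- x) <= p x.
Proof.
move=> sp; have [pD _] := sp; have := pD x (- x).
by rewrite subrr sublinear0//; lra.
Qed.

(** Serves both for the one-parameter family of [sublinear_shift] and for chains in Zorn's lemma.
    The minorant [l] keeps the infima finite; the two closure conditions let near-optimal members
    for [x] and [y] be replaced by a single member at [x + y], and likewise for dilations. *)
Lemma inf_sublinear (P : set (V -> R)) (l : V -> R) : P !=set0 ->
  (forall p x, P p -> l x <= p x) ->
  (forall p q x y, P p -> P q -> exists2 r, P r & r (x + y) <= p x + q y) ->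
  (forall p (a : R) x, P p -> 0 < a -> exists2 r, P r & r (a *: x) <= a * p x) ->
  let m x := inf [set p x | p in P] in
  sublinear m /\ (forall p x, P p -> m x <= p x).
Proof.
move=> [p0 Pp0] Pl PD PZ m.
have mlb p x : P p -> m x <= p x.
  move=> Pp; apply: ge_inf; last by exists p.
  by exists (l x) => _ [q Pq <-]; exact: Pl.
have mi x : has_inf [set p x | p in P].
  split; first by exists (p0 x), p0.
  by exists (l x) => _ [q Pq <-]; exact: Pl.
split => //; split=> [x y|a x a0]; apply/ler_addgt0Pr => e e0.
- have e2 : 0 < e / 2 by rewrite divr_gt0.
  have [_ [p Pp <-] px] := inf_adherent e2 (mi x).
  have [_ [q Pq <-] qy] := inf_adherent e2 (mi y).
  have [r Pr rxy] := PD p q x y Pp Pq.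
  have := mlb r (x + y) Pr; rewrite -/(m x) -/(m y) in px qy *; lra.
- have [_ [p Pp <-] px] := inf_adherent (divr_gt0 e0 a0) (mi x).
  have [r Pr rx] := PZ p a x Pp a0.
  apply: le_trans (mlb _ _ Pr) (le_trans rx _).
  rewrite mulrC -ler_pdivlMr// mulrDl mulrAC mulfV ?gt_eqF// mul1r.
  exact: ltW.
Qed.

(* The infimum over [t >= 0] is the largest sublinear functional below [p]
   whose value at [- v] is at most [- p v]. *)
Lemma sublinear_shift p v : sublinear p ->
  exists q, [/\ sublinear q, (forall x, q x <= p x) & q (- v) <= - p v].
Proof.
move=> sp; have [pD pZ] := sp.
have pZ' (a : R) x : 0 <= a -> p (a *: x) <= a * p x.
  rewrite le_eqVlt => /predU1P[<-|]; last exact: pZ.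
  by rewrite scale0r sublinear0// mul0r.
pose P := [set (fun x => p (x + t *: v) - t * p v) | t in [set t : R | 0 <= t]].
have [] := @inf_sublinear P (fun x => - p (- x)).
- by exists (fun x => p (x + 0 *: v) - 0 * p v), 0 => /=.
- move=> _ x [t /= t0 <-].
  have := pD (x + t *: v) (- x); rewrite addrAC subrr add0r => h.
  have := sublinearN_ge (t *: v) sp.
  have : p (t *: v) <= p (x + t *: v) + p (- x) by [].
  have : t * p v <= p (t *: v).
    move: t0; rewrite /= le_eqVlt => /predU1P[<-|t0].
      by rewrite mul0r scale0r sublinear0.
    have := pZ t^-1 (t *: v); rewrite invr_gt0 => /(_ t0).
    by rewrite scalerA mulVf ?gt_eqF// scale1r mulrC ler_pdivlMr// mulrC.
  lra.
- move=> _ _ x y [s /= s0 <-] [t /= t0 <-].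
  exists (fun x => p (x + (s + t) *: v) - (s + t) * p v).
    by exists (s + t) => //=; exact: addr_ge0.
  rewrite scalerDl addrACA mulrDl; have := pD (x + s *: v) (y + t *: v); lra.
- move=> _ a x [t /= t0 <-] a0.
  exists (fun x => p (x + (a * t) *: v) - (a * t) * p v).
    by exists (a * t) => //=; rewrite mulr_ge0// ltW.
  rewrite -scalerA -scalerDr mulrBr mulrA lerD2r; exact: pZ.
move=> sm mle; exists (fun x => inf [set q x | q in P]); split => //.
- move=> x; have P0 : P (fun x => p (x + 0 *: v) - 0 * p v) by exists 0 => /=.
  by have := mle _ x P0; rewrite scale0r addr0 mul0r subr0.
- have P1 : P (fun x => p (x + 1 *: v) - 1 * p v) by exists 1 => //=.
  by have := mle _ (- v) P1; rewrite scale1r addNr sublinear0// sub0r mul1r.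
Qed.

(** Zorn's lemma for the reversed pointwise order: the infimum of a nonempty chain is sublinear, and
    it is finite because every sublinear functional below [p0] is at least [- p0 (- x)] at [x]. *)
Lemma minimal_sublinear p0 : sublinear p0 ->
  exists p, [/\ sublinear p, (forall x, p x <= p0 x) &
    forall q, sublinear q -> (forall x, q x <= p x) -> q = p].
Proof.
move=> sp0; pose T := {p | sublinear p /\ forall x, p x <= p0 x}.
have [] := @Zorn T (fun p q : T => `[< forall x, sval q x <= sval p x >]).
- by move=> p; apply/asboolP.
- move=> p q r /asboolP pq /asboolP qr; apply/asboolP => x.
  exact: le_trans (qr x) (pq x).
- move=> [p Hp] [q Hq] /asboolP /= pq /asboolP /= qp.
  have e : p = q by apply/funext => x; apply/eqP; rewrite eq_le pq qp.
  by subst q; congr exist; exact: Prop_irrelevance.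
- move=> A totA; have [[a0 Aa0]|nA] := pselect (A !=set0); last first.
    by exists (exist _ p0 (conj sp0 (fun=> lexx _))) => s As; case: nA; exists s.
  have [] := @inf_sublinear [set sval a | a in A] (fun x => - p0 (- x)).
  + by exists (sval a0), a0.
  + move=> _ x [[p [sp pp0]] _ <-] /=.
    by have := sublinearN_ge x sp; have := pp0 (- x); lra.
  + move=> _ _ x y [p Ap <-] [q Aq <-].
    have [/asboolP pq|/asboolP qp] := totA _ _ Ap Aq.
      exists (sval q); first by exists q.
      by have := (svalP q).1.1 x y; have := pq x; lra.
    exists (sval p); first by exists p.
    by have := (svalP p).1.1 x y; have := qp y; lra.
  + move=> _ a x [p Ap <-] a0'; exists (sval p); first by exists p.
    exact: (svalP p).1.2.
  move=> sm mle.
  have mp0 x : inf [set q x | q in [set sval a | a in A]] <= p0 x.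
    apply: le_trans ((svalP a0).2 x); apply: mle; by exists a0.
  exists (exist (fun p => sublinear p /\ forall x, p x <= p0 x) _ (conj sm mp0)) => s As; apply/asboolP => x /=.
  by apply: mle; exists s.
move=> [p [sp pp0]] pmin; exists p; split => // q sq qp.
have qp0 x : q x <= p0 x by exact: le_trans (qp x) (pp0 x).
have := pmin (exist (fun p => sublinear p /\ forall x, p x <= p0 x) q (conj sq qp0))
  ltac:(by apply/asboolP).
by move=> /(congr1 sval).
Qed.

(** By minimality the shift of [p] along [x] is [p] itself, so [p (- x) <= - p x] and [p] is odd.
    Oddness turns both sublinearity inequalities into equalities. *)
Lemma minimal_sublinear_linear p : sublinear p ->
  (forall q, sublinear q -> (forall x, q x <= p x) -> q = p) ->
  linear (p : V -> R^o).
Proof.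
move=> sp pmin; have [pD pZ] := sp.
have pN x : p (- x) = - p x.
  have [q [sq qp qx]] := sublinear_shift x sp.
  rewrite (pmin q sq qp) in qx.
  have := sublinearN_ge x sp; lra.
have pDE x y : p (x + y) = p x + p y.
  have := pD (- x) (- y); have := pD x y; rewrite -opprD !pN; lra.
have pZE (a : R) x : 0 < a -> p (a *: x) = a * p x.
  move=> a0; have := pZ a x a0; have := pZ a (- x) a0.
  rewrite scalerN !pN; lra.
move=> a x y; rewrite pDE; congr (_ + _).
have [a0|a0|<-] := ltgtP 0 a; [exact: pZE| |].
  by rewrite -[a]opprK scaleNr pN pZE ?oppr_gt0// -mulNr.
by rewrite !scale0r sublinear0.
Qed.

(** The norm is shifted along [v] before minimizing, so that every functional below the result is at
    most [- |v|] at [- v]; linearity then forces the value [|v|] at [v]. *)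
Lemma hahn_banach_norm v :
  exists f : V -> R, [/\ linear (f : V -> R^o), (forall x, `|f x| <= `|x|) &
    f v = `|v|].
Proof.
have sn : sublinear (fun x : V => `|x|).
  by split=> [x y|a x a0]; [exact: ler_normD|rewrite normrZ gtr0_norm].
have [q [sq qn qv]] := sublinear_shift v sn.
have [f [sf fq fmin]] := minimal_sublinear sq.
have lf := minimal_sublinear_linear sf fmin.
have fN x : f (- x) = - f x.
  by have := lf (-1) x 0; rewrite !addr0 scaleN1r sublinear0// addr0 scaleN1r.
have fle x : f x <= `|x| by exact: le_trans (fq x) (qn x).
exists f; split => //.
  by move=> x; rewrite ler_norml fle andbT lerNl -fN -normrN.
by have := fle v; have := fq (- v); rewrite fN; lra.
Qed.

End hahn_banach.

(** * Weak* separability in terms of approximation at finitely many points *)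

Section weak_star_density.
Context {R : realType} {Y : normedModType R}.
Implicit Types (A D : set (Y -> R)).

(** Approximation at one point at a time is all that total and norming sequences require. The member
    [f] of [A] makes the dense set nonempty, hence enumerable by a sequence. *)
Lemma wstar_separable_sequence A f : A f -> separable_space (wstar A) ->
  exists d : nat -> Y -> R, (forall n, A (d n)) /\
    forall f y (e : R), A f -> 0 < e -> exists n, `|d n y - f y| < e.
Proof.
move=> Af [D cD dD]; pose W := wstar A.
have approx h y (e : R) : A h -> 0 < e ->
    exists u : W, D u /\ `|(val u : Y -> R) y - h y| < e.
  move=> Ah e0.
  pose N := [set g : {ptws Y -> R} | ball (h y) e (g y)].
  have nN : nbhs (h : {ptws Y -> R}) N.
    have /pointwise_cvgP/(_ y) H : {ptws, nbhs (h : {ptws Y -> R}) --> h} by [].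
    exact: H (nbhsx_ballx _ _ e0).
  have [u [Du Ou]] : exists u : W, D u /\ N (val u).
    have [U [oU Uh] UO] : exists2 U : set {ptws Y -> R}, open U /\ U h & U `<=` N.
      by move: nN; rewrite nbhsE => -[U [? ?] ?]; exists U.
    pose V := (fun u : W => val u : {ptws Y -> R}) @^-1` U.
    have V0 : V !=set0 by exists (SigSub (mem_set Ah)).
    have oV : open V by exists U.
    have [u [Uu Du]] := dD V V0 oV.
    by exists u; split => //; exact: UO.
  exists u; split => //; rewrite distrC.
  exact: Ou.
have [u0 [Du0 _]] := approx f 0 1 Af ltr01.
have [d dE] : exists d : nat -> W, D `<=` range d.
  have /pfcard_geP[D0|[g]] := cD; first by move: Du0; rewrite D0.
  exists g => u Du; have [n _ <-] := @surj _ _ _ _ g u Du; by exists n.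
exists (fun n => val (d n)); split=> [n|h y e Ah e0].
  by have /set_mem := valP (d n).
have [u [Du hu]] := approx h y e Ah e0.
by have [n _ nu] := dE _ Du; exists n; rewrite nu.
Qed.

Lemma approx_separable_wstar A D : countable D -> D `<=` A ->
  (forall f (xs : seq Y) (e : R), A f -> 0 < e ->
     exists2 g, D g & forall x, x \in xs -> `|g x - f x| < e) ->
  separable_space (wstar A).
Proof.
move=> cD DA approx; pose W := wstar A.
exists ((fun u : W => val u) @^-1` D).
  apply: sub_countable cD; rewrite -(card_le_eql (inj_card_eq (f := val) _)).
    by apply: subset_card_le => _ [u Du <-].
  by move=> u v _ _; exact: val_inj.
move=> V [u Vu] [N oN NV]; rewrite -NV in Vu *.
pose f : Y -> R := val u; have Af : A f by have /set_mem := valP u.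
(* [F] is generated by the traces on [A] of the basic neighbourhoods of [f]. It converges pointwise
   to [f], so it contains the open set [N]; no explicit base of the product topology is needed. *)
pose F : set_system {ptws Y -> R} := [set P | exists (xs : seq Y) (e : R),
  0 < e /\ forall g, A g -> (forall x, x \in xs -> `|g x - f x| < e) -> P g].
have FF : Filter F.
  split.
  - by exists [::], 1.
  - move=> P Q [xs [e [e0 HP]]] [ys [d [d0 HQ]]].
    exists (xs ++ ys), (Num.min e d); split; first by rewrite lt_min e0.
    move=> g Ag H; split; [apply: HP => // x xin|apply: HQ => // x xin].
      by have := H x; rewrite mem_cat xin lt_min => /(_ isT)/andP[].
    by have := H x; rewrite mem_cat xin orbT lt_min => /(_ isT)/andP[].
  - move=> P Q PQ [xs [e [e0 HP]]]; exists xs, e; split => // g Ag H.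
    exact/PQ/HP.
have Ff : {ptws, F --> f}.
  apply/pointwise_cvgP => x; apply/cvgrPdist_lt => e e0.
  exists [:: x], e; split => // g Ag /(_ x (mem_head _ _)) /=.
  by rewrite distrC.
have [xs [e [e0 H]]] : F N by apply: Ff; exact: open_nbhs_nbhs.
have [g Dg gf] := approx f xs e Af e0.
exists (SigSub (mem_set (DA _ Dg))); split => //=.
apply: H => //; exact: DA.
Qed.

End weak_star_density.

(** * Nearest points in midpoint-convex sets of functionals *)

Lemma parallelogram_bound (R : realFieldType) (s u v z d r t : R) :
  s + 4 * u = 2 * v + 2 * z ->
  v < d + r -> z < d + t -> t <= r -> d <= u -> s <= 4 * r.
Proof. lra. Qed.

Section midpoint_convex.
Context {R : realType} {Y : normedModType R}.
Implicit Types (M : set (Y -> R)) (f g : Y -> R).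

Definition mid f g : Y -> R := fun y => (f y + g y) / 2.

Lemma scalar_fun0 f : linear (f : Y -> R^o) -> f 0 = 0.
Proof. by move=> lf; have := lf (-1) 0 0; rewrite scaler0 addr0 scaleN1r addNr. Qed.

Lemma scalar_fun_sum f (xs : seq Y) (a : Y -> R) : linear (f : Y -> R^o) ->
  f (\sum_(x <- xs) a x *: x) = \sum_(x <- xs) a x * f x.
Proof.
move=> lf; elim: xs => [|x xs IH]; first by rewrite !big_nil scalar_fun0.
by rewrite !big_cons lf IH.
Qed.

Section nearest_point.
Variables (M : set (Y -> R)) (f : Y -> R) (xs : seq Y).
Hypothesis M0 : M !=set0.
Hypothesis Mmid : forall g h, M g -> M h -> M (mid g h).

Let q g := \sum_(x <- xs) (f x - g x) ^+ 2.

Let q_ge0 g : 0 <= q g.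
Proof. by apply: sumr_ge0 => x _; exact: sqr_ge0. Qed.

Let d := inf [set q g | g in M].

Let d_le g : M g -> d <= q g.
Proof.
by move=> Mg; apply: ge_inf; [exists 0 => _ [h _ <-]; exact: q_ge0|exists g].
Qed.

Let minimizing : exists c : nat -> Y -> R,
  forall k, M (c k) /\ q (c k) < d + k.+1%:R^-1.
Proof.
suff /choice[c cP] : forall k, exists g, M g /\ q g < d + k.+1%:R^-1 by exists c.
move=> k; have [||_ [g Mg <-] ?] := @inf_adherent R [set q g | g in M] k.+1%:R^-1.
- by rewrite invr_gt0.
- split; first by have [g Mg] := M0; exists (q g), g.
  by exists 0 => _ [h _ <-]; exact: q_ge0.
- by exists g.
Qed.

(** Taking the midpoint with [g] halves the parameter. Midpoint convexity thus yields points of the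
    segment arbitrarily close to [g], enough for a first-order variation. *)
Lemma dyadic_mem j g h : M g -> M h ->
  M (fun y => g y + 2^-1 ^+ j * (h y - g y)).
Proof.
move=> Mg Mh; elim: j => [|j IH].
  by rewrite (_ : (fun _ => _) = h)//; apply/funext => y; rewrite expr0; ring.
have := Mmid Mg IH; congr (M _); apply/funext => y.
by rewrite /mid exprS; field.
Qed.

(** On the coordinates [xs], a minimizing sequence [c] converges to the projection of [f] onto the
    closure of [M]. The residual is [a], and the last clause is the variational inequality of the
    projection. *)
Lemma nearest_point : exists (c : nat -> Y -> R) (a : Y -> R),
  [/\ (forall k, M (c k)),
      (forall x, x \in xs -> c k x @[k --> \oo] --> f x - a x) &
      (forall g, M g -> \sum_(x <- xs) a x * (g x - (f x - a x)) <= 0)].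
Proof.
have [c cP] := minimizing.
have Mc k : M (c k) by have [] := cP k.
have dist x k l : x \in xs -> (k <= l)%N ->
    (c k x - c l x) ^+ 2 <= 4 * k.+1%:R^-1.
  move=> xxs kl; apply: (@le_trans _ _ (\sum_(y <- xs) (c k y - c l y) ^+ 2)).
    (* The parallelogram identity for the residuals of [c k] and [c l] comes next: their midpoint
       lies in [M], so its squared distance to [f] is at least [d]. *)
    rewrite (big_rem x)//= lerDl; apply: sumr_ge0 => y _; exact: sqr_ge0.
  have E : \sum_(y <- xs) (c k y - c l y) ^+ 2 + 4 * q (mid (c k) (c l)) =
      2 * q (c k) + 2 * q (c l).
    rewrite /q !mulr_sumr -!big_split /=; apply: eq_bigr => y _.
    by rewrite /mid; field.
  have := d_le (Mmid (Mc k) (Mc l)); have [_ qk] := cP k; have [_ ql] := cP l.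
  have : l.+1%:R^-1 <= k.+1%:R^-1 :> R by rewrite lef_pV2 ?posrE// ler_nat.
  move=> tr du; exact: parallelogram_bound E qk ql tr du.
have cvgc x : x \in xs -> cvgn (fun k => c k x).
  move=> xxs; apply/cauchy_cvgP/cauchy_exP => e e0.
  have e4 : 0 < e ^+ 2 / 4 by rewrite divr_gt0// exprn_gt0.
  have [N _ HN] := near_infty_natSinv_lt (PosNum e4).
  exists (c N x); exists N => // l /= Nl.
  rewrite /ball /= -(@ltr_pXn2r _ 2)// ?nnegrE ?normr_ge0//; last exact: ltW.
  rewrite real_normK ?num_real//; apply: le_lt_trans (dist _ _ _ xxs Nl) _.
  have : N.+1%:R^-1 < e ^+ 2 / 4 := HN N (leqnn _).
  by rewrite ltr_pdivlMr// mulrC.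
pose a x := f x - lim (c k x @[k --> \oo]).
have ca x : x \in xs -> c k x @[k --> \oo] --> f x - a x.
  by move=> xxs; rewrite /a subKr; exact: cvgc.
(* Squared distances along the segment from [c k] to [g] pass to the limit. The case [t = 0] bounds
   the norm of the residual; [t = 2^-j] gives the variational inequality. *)
have cvgF t g : \sum_(x <- xs) (f x - (c k x + t * (g x - c k x))) ^+ 2
    @[k --> \oo] --> \sum_(x <- xs) (a x - t * (g x - (f x - a x))) ^+ 2.
  rewrite big_seq; under eq_fun do rewrite big_seq.
  apply: (@cvg_big _ _ +%R) => [|x xxs]; first exact: add_continuous.
  have -> : a x - t * (g x - (f x - a x)) =
      f x - (f x - a x + t * (g x - (f x - a x))) by ring.
  rewrite expr2; under eq_fun do rewrite expr2.
  have H : f x - (c k x + t * (g x - c k x)) @[k --> \oo] -->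
      f x - (f x - a x + t * (g x - (f x - a x))).
    apply: cvgB; first exact: cvg_cst.
    apply: cvgD; first exact: ca.
    apply: cvgM; first exact: cvg_cst.
    by apply: cvgB; [exact: cvg_cst|exact: ca].
  exact: cvgM.
have ad : \sum_(x <- xs) a x ^+ 2 <= d.
  have -> : \sum_(x <- xs) a x ^+ 2 =
      \sum_(x <- xs) (a x - 0 * (f x - (f x - a x))) ^+ 2.
    by apply: eq_bigr => x _; rewrite mul0r subr0.
  apply: (ler_cvg_to (cvgF 0 f) (g := fun k => d + k.+1%:R^-1)).
    rewrite -[X in _ --> X]addr0; apply: cvgD; first exact: cvg_cst.
    exact: cvg_harmonic.
  apply: nearW => k; under eq_bigr do rewrite mul0r addr0.
  by apply: ltW; have [] := cP k.
exists c, a; split => // g Mg.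
pose w x := g x - (f x - a x).
(* Minimality at parameter [t = 2^-j] is expanded and divided by [t]; letting [j] grow leaves only
   the first-order term. *)
have ineq j : 2 * \sum_(x <- xs) a x * w x <=
    2^-1 ^+ j * \sum_(x <- xs) w x ^+ 2.
  set t : R := 2^-1 ^+ j; have t0 : 0 < t by rewrite exprn_gt0.
  have : d <= \sum_(x <- xs) (a x - t * w x) ^+ 2.
    apply: (ler_cvg_to (cvg_cst d) (cvgF t g)); apply: nearW => k.
    exact: d_le (dyadic_mem j (Mc k) Mg).
  have -> : \sum_(x <- xs) (a x - t * w x) ^+ 2 = \sum_(x <- xs) a x ^+ 2
      - t * (2 * \sum_(x <- xs) a x * w x) + t ^+ 2 * \sum_(x <- xs) w x ^+ 2.
    rewrite !mulr_sumr -sumrB -big_split /=.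
    by apply: eq_bigr => x _; ring.
  move=> H; rewrite -(ler_pM2l t0) [X in _ <= X]mulrA -expr2; lra.
have : 2 * \sum_(x <- xs) a x * w x <= 0 * \sum_(x <- xs) w x ^+ 2.
  apply: (@ler_cvg_to _ _ eventually_filter _
    (fun=> 2 * \sum_(x <- xs) a x * w x)
    (fun j => 2^-1 ^+ j * \sum_(x <- xs) w x ^+ 2)); first exact: cvg_cst.
    apply: cvgM; last exact: cvg_cst.
    by apply: cvg_expr; rewrite ger0_norm//; lra.
  by apply: nearW.
rewrite mul0r /w; lra.
Qed.

End nearest_point.

(** The support hypothesis is applied to the vector whose coefficients are the residuals [a x].
    Together with the variational inequality it gives that the sum of the [a x ^+ 2] is at most 0,
    so the projection agrees with [f] on [xs]. *)
Lemma support_approx M f (xs : seq Y) (e : R) : M !=set0 ->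
  (forall g h, M g -> M h -> M (mid g h)) ->
  (forall g, M g -> linear (g : Y -> R^o)) -> linear (f : Y -> R^o) ->
  (forall y b, (forall g, M g -> g y <= b) -> f y <= b) -> 0 < e ->
  exists2 g, M g & forall x, x \in xs -> `|g x - f x| < e.
Proof.
move=> M0 Mmid Mlin flin fle e0.
have [c [a [Mc ca aM]]] := nearest_point f xs M0 Mmid.
have {}fle := fle (\sum_(x <- xs) a x *: x) (\sum_(x <- xs) a x * (f x - a x)).
have : \sum_(x <- xs) a x * f x <= \sum_(x <- xs) a x * (f x - a x).
  rewrite -scalar_fun_sum//; apply: fle => g Mg.
  rewrite scalar_fun_sum; last exact: Mlin.
  have := aM g Mg; under eq_bigr do rewrite mulrBr; rewrite sumrB; lra.
under [X in _ <= X]eq_bigr do rewrite mulrBr -expr2.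
rewrite sumrB => suma2.
have a0 x : x \in xs -> a x = 0.
  move=> xxs; apply/eqP; rewrite -sqrf_eq0 eq_le sqr_ge0 andbT.
  have : a x ^+ 2 <= \sum_(y <- xs) a y ^+ 2.
    by rewrite (big_rem x)//= lerDl; apply: sumr_ge0 => y _; exact: sqr_ge0.
  lra.
have [k Hk] : exists k, forall x, x \in xs -> `|c k x - f x| < e.
  have : \forall k \near \oo, forall x, x \in xs -> `|c k x - f x| < e.
    elim: (xs) (ca) (a0) => [|x s IH] cas a0s; first by apply: nearW.
    have {}IH : \forall k \near \oo, forall y, y \in s -> `|c k y - f y| < e.
      by apply: IH => y ys; [apply: cas|apply: a0s]; rewrite in_cons ys orbT.
    have /cvgrPdist_lt/(_ _ e0) H2 := cas x (mem_head x s).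
    rewrite a0s ?mem_head// subr0 in H2.
    near=> k => y; rewrite in_cons => /predU1P[->|ys].
      by rewrite distrC; near: k.
    by move: y ys; near: k.
  by move=> [k _ /(_ k (leqnn k)) Hk]; exists k.
by exists (c k).
Unshelve. all: by end_near. Qed.

End midpoint_convex.

(** * Separability from a countable set with the right support function *)

Section separability_criterion.
Context {R : realType} {Y : normedModType R}.
Implicit Types (A K : set (Y -> R)).

Definition mid_step K := [set mid p.1 p.2 | p in K `*` K].

Definition mid_closure K := \bigcup_n iter n mid_step K.

Lemma countable_mid_closure K : countable K -> countable (mid_closure K).
Proof.
move=> cK; apply: bigcup_countable => // n _; elim: n => [|n IH] //=.
exact: sub_countable (card_image_le _ _) (countableX IH IH).
Qed.

Lemma sub_mid_closure K : K `<=` mid_closure K.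
Proof. by move=> f Kf; exists 0%N. Qed.

Lemma mid_mid_closure K f g :
  mid_closure K f -> mid_closure K g -> mid_closure K (mid f g).
Proof.
(* The stages increase because every functional is its own midpoint. *)
have mono m n : (m <= n)%N -> iter m mid_step K `<=` iter n mid_step K.
  elim: n => [|n IH]; first by rewrite leqn0 => /eqP->.
  rewrite leq_eqVlt => /predU1P[->//|/IH mn h /mn Kh]; exists (h, h) => //.
  by apply/funext => y; rewrite /mid /=; field.
move=> [m _ mf] [n _ ng]; exists (maxn m n).+1 => //=.
exists (f, g) => //; split.
  exact: (mono m) (leq_maxl _ _) _ mf.
exact: (mono n) (leq_maxr _ _) _ ng.
Qed.

Lemma mid_closure_sub K A : K `<=` A ->
  (forall f g, A f -> A g -> A (mid f g)) -> mid_closure K `<=` A.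
Proof.
move=> KA Amid f [n _]; elim: n f => [|n IH] f /=; first exact: KA.
by move=> [[g h] [/IH Ag /IH Ah] <-]; exact: Amid.
Qed.

(* The hypothesis on [K] says that no weak* closed half-space contains [K]
   without containing [A]. *)
Lemma separable_wstar_of_support A K : countable K -> K !=set0 -> K `<=` A ->
  (forall f g, A f -> A g -> A (mid f g)) ->
  (forall f, A f -> linear (f : Y -> R^o)) ->
  (forall f y b, A f -> (forall g, K g -> g y <= b) -> f y <= b) ->
  separable_space (wstar A).
Proof.
move=> cK [g0 Kg0] KA Amid Alin Ale.
have MA := mid_closure_sub KA Amid.
apply: (approx_separable_wstar (countable_mid_closure cK) MA).
move=> f xs e Af e0; apply: support_approx => //.
- by exists g0; exact: sub_mid_closure.
- exact: mid_mid_closure.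
- by move=> g /MA; exact: Alin.
- exact: Alin.
- move=> y b H; apply: Ale Af _ => g Kg.
  exact/H/sub_mid_closure.
Qed.

End separability_criterion.

(** * The summation functional on real summable families *)

Section l1_functional.
Context {R : realType} {I : choiceType}.
Local Notation l1 := (l1sum (fun _ : I => R^o : normedModType R)).
Implicit Types (h k u : l1).

Lemma l1_dominated_le {X Z : I -> normedModType R} (x : l1sum X)
    (f : forall i, Z i) : (forall i, `|f i| <= `|x i|) ->
  (\esum_(i in [set: I]) (`|f i|)%:E <= (l1norm x)%:E)%E.
Proof. by move=> fx; rewrite l1normE; apply: le_esum => i _; rewrite lee_fin. Qed.

Definition l1_dominated {X Z : I -> normedModType R} (x : l1sum X)
    (f : forall i, Z i) (fx : forall i, `|f i| <= `|x i|) : l1sum Z :=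
  L1sum (l1_summable (l1_dominated_le fx)).

Lemma norm_l1E {X : I -> normedModType R} (x : l1sum X) : `|x| = l1norm x.
Proof. by []. Qed.

Lemma le_norm_l1 {X Z : I -> normedModType R} (x : l1sum X) (z : l1sum Z) :
  (forall i, `|z i| <= `|x i|) -> `|z| <= `|x|.
Proof.
move=> zx; rewrite !norm_l1E -lee_fin l1normE.
exact: l1_dominated_le.
Qed.

Lemma norm_l1D_ge0 h k : (forall i, 0 <= h i :> R) -> (forall i, 0 <= k i :> R) ->
  `|h + k| = `|h| + `|k|.
Proof.
move=> h0 k0; apply: EFin_inj; rewrite EFinD !norm_l1E !l1normE -esumD//.
by apply: eq_esum => i _; rewrite -EFinD [`|(h + k) i|]ger0_norm ?addr_ge0// !ger0_norm.
Qed.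

Lemma l1_abs_le h i : `|(`|h i| : R^o)| <= `|h i|.
Proof. by rewrite normr_id. Qed.

Definition l1_abs h : l1 := l1_dominated (l1_abs_le h).

(* [h + |h|] and [|h|] are nonnegative, and the norm is additive on
   nonnegative families. *)
Definition l1_total h : R := `|h + l1_abs h| - `|l1_abs h|.

Lemma l1_add_abs_ge0 h i : 0 <= (h + l1_abs h) i :> R.
Proof.
change (0 <= (h i : R) + `|h i : R|).
by rewrite -lerBlDl sub0r -normrN; exact: ler_norm.
Qed.

Lemma l1_totalD h k : l1_total (h + k) = l1_total h + l1_total k.
Proof.
pose pos u := forall i, 0 <= u i :> R.
have absP u : pos (l1_abs u) by move=> i; exact: normr_ge0.
have addP u : pos (u + l1_abs u) by exact: l1_add_abs_ge0.
have sumP u v : pos u -> pos v -> pos (u + v) by move=> u0 v0 i; exact: addr_ge0.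
(* Every group in this identity is a nonnegative family, so taking norms gives a linear relation
   between the norms that define the three totals. *)
have E : (h + k + l1_abs (h + k)) + (l1_abs h + l1_abs k) =
    (h + l1_abs h) + (k + l1_abs k) + l1_abs (h + k).
  apply: l1sum_eq => i.
  change ((h i : R) + k i + `|(h i : R) + k i| + (`|h i : R| + `|k i : R|) =
    (h i + `|h i : R|) + (k i + `|k i : R|) + `|(h i : R) + k i|); ring.
have := congr1 (fun u : l1 => `|u|) E.
rewrite (norm_l1D_ge0 (addP (h + k)) (sumP _ _ (absP h) (absP k))).
rewrite (norm_l1D_ge0 (absP h) (absP k)).
rewrite (norm_l1D_ge0 (sumP _ _ (addP h) (addP k)) (absP (h + k))).
rewrite (norm_l1D_ge0 (addP h) (addP k)) /l1_total; lra.
Qed.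

Lemma l1_totalN h : l1_total (- h) = - l1_total h.
Proof.
have : l1_total (- h + h) = 0.
  rewrite addNr /l1_total add0r; lra.
by rewrite l1_totalD; lra.
Qed.

Lemma l1_totalZ (a : R) h : l1_total (a *: h) = a * l1_total h.
Proof.
have pos (b : R) : 0 <= b -> l1_total (b *: h) = b * l1_total h.
  move=> b0; rewrite /l1_total.
  have -> : l1_abs (b *: h) = b *: l1_abs h.
    apply: l1sum_eq => i; change (`|b * h i| = b * `|h i| :> R).
    by rewrite normrM ger0_norm.
  by rewrite -scalerDr !normrZ ger0_norm// mulrBr.
have [/pos//|/ltW a0] := leP 0 a.
by rewrite -[a]opprK scaleNr l1_totalN pos ?oppr_ge0// -mulNr.
Qed.

Lemma l1_total_ge0 h : (forall i, 0 <= h i :> R) -> l1_total h = `|h|.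
Proof.
move=> h0; rewrite /l1_total (norm_l1D_ge0 h0 (k := l1_abs h)).
  by rewrite addrK.
by move=> i; exact: normr_ge0.
Qed.

Lemma l1_total_le h : `|l1_total h| <= `|h|.
Proof.
have le k : l1_total k <= `|k|.
  by have := ler_normD k (l1_abs k); rewrite /l1_total; lra.
by rewrite ler_norml le andbT lerNl -l1_totalN -[leRHS]normrN.
Qed.

Lemma l1_restrict_le (P : pred I) h i :
  `|(if P i then h i else 0 : R^o)| <= `|h i|.
Proof. by case: ifP => // _; rewrite normr0. Qed.

Definition l1_restrict (P : pred I) h : l1 := l1_dominated (l1_restrict_le P h).

Lemma l1_restrictC P h :
  h = l1_restrict P h + l1_restrict (predC P) h.
Proof.
apply: l1sum_eq => i.
change (h i = (if P i then h i else 0) + (if ~~ P i then h i else 0) :> R).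
by case: (P i); rewrite /= ?addr0 ?add0r.
Qed.

Lemma norm_l1_single i h : `|l1_restrict (pred1 i) h| = `|h i : R|.
Proof.
apply: EFin_inj; rewrite norm_l1E l1normE.
rewrite -(@esum_set1 _ _ i (fun j => (`|h j : R|)%:E))// [in RHS]esum_mkcond.
apply: eq_esum => j _ /=; rewrite classical_sets.in_set1.
by case: eqP => [->//|_]; rewrite normr0.
Qed.

Lemma l1_total_single i h : l1_total (l1_restrict (pred1 i) h) = h i.
Proof.
have pos k : (0 <= k i :> R) -> l1_total (l1_restrict (pred1 i) k) = k i.
  move=> ki; rewrite l1_total_ge0 ?norm_l1_single ?ger0_norm// => j.
  by rewrite /l1_restrict /=; case: eqP => // ->.
have [/pos//|/ltW hi] := leP 0 (h i : R).
apply: oppr_inj; rewrite -l1_totalN.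
have hN : 0 <= (- h) i :> R by change (0 <= - (h i : R)); rewrite oppr_ge0.
transitivity (l1_total (l1_restrict (pred1 i) (- h))); last exact: pos hN.
congr l1_total; apply: l1sum_eq => j.
change (- (if j == i then h j else 0) = (if j == i then - h j else 0) :> R).
by case: eqP; rewrite ?oppr0.
Qed.

Lemma l1_total_finite (F : seq I) h : uniq F ->
  l1_total (l1_restrict (mem F) h) = \sum_(i <- F) (h i : R).
Proof.
elim: F => [|i F IH] /= => [_|/andP[iF uF]].
  rewrite big_nil (_ : l1_restrict _ h = 0 *: h) ?l1_totalZ ?mul0r//.
  by apply: l1sum_eq => i; rewrite scale0r.
rewrite big_cons -IH// -[X in X + _]l1_total_single -l1_totalD.
congr l1_total; apply: l1sum_eq => j.
change ((if j \in i :: F then h j else 0) =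
  (if j == i then h j else 0) + (if j \in F then h j else 0) :> R).
rewrite in_cons; case: eqP => [->|_] /=; last by rewrite add0r.
by rewrite (negbTE iF) addr0.
Qed.

(** Both differences are totals of restrictions to the complement of [F], where [u] dominates
    [h]. *)
Lemma l1_total_approx (F : seq I) h u : uniq F ->
  (forall i, `|h i : R| <= u i :> R) ->
  `|l1_total h - \sum_(i <- F) (h i : R)| <= `|u| - \sum_(i <- F) (u i : R).
Proof.
move=> uF hu; have u0 i : 0 <= u i :> R by exact: le_trans (hu i).
have split k : l1_total k - \sum_(i <- F) (k i : R) =
    l1_total (l1_restrict (predC (mem F)) k).
  rewrite -l1_total_finite// [in X in X - _](l1_restrictC (mem F) k) l1_totalD.
  by rewrite addrAC subrr add0r.
rewrite -(l1_total_ge0 u0) !split.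
apply: le_trans (l1_total_le _) _; rewrite l1_total_ge0; last first.
  by move=> i; rewrite /l1_restrict /=; case: ifP.
apply: le_norm_l1 => i; rewrite /l1_restrict /=; case: ifP => // _.
by rewrite [leRHS]ger0_norm.
Qed.

End l1_functional.

(** * A countable family of functions interpolating all finite prescriptions *)

Section independent_family.
Context {I : eqType} (e : I -> nat -> bool).
Hypothesis e_inj : injective e.

(** A function on [I] is coded by a finite table from bit prefixes to values, so there are only
    countably many codes. The first matching prefix wins, and 0 is the default. *)
Fixpoint prefix_lookup (s : seq (seq bool * nat)) (i : I) : nat :=
  if s is (b, n) :: s' then
    if b == mkseq (e i) (size b) then n else prefix_lookup s' i
  else 0%N.

Lemma separating_prefix (i : I) (F : seq I) :
  exists k, forall j, j \in F -> mkseq (e i) k = mkseq (e j) k -> j = i.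
Proof.
suff [k kP] : exists k, forall j, j \in F -> j != i ->
    exists2 l, (l < k)%N & e i l != e j l.
  exists k => j jF ij; apply/eqP; apply: contraT => ji.
  have [l lk] := kP j jF ji; move/(congr1 (nth false ^~ l)): ij.
  by rewrite !nth_mkseq// => ->; rewrite eqxx.
elim: F => [|j F [k kP]]; first by exists 0%N.
have [ij|ji] := eqVneq j i.
  exists k => l; rewrite in_cons => /predU1P[->|]; first by rewrite ij eqxx.
  exact: kP.
have [l el] : exists l, e i l != e j l.
  apply: contrapT => /forallNP H; case/eqP: ji; apply: e_inj; apply/funext => l.
  by have /negP := H l; rewrite negbK => /eqP.
exists (maxn k l.+1) => m; rewrite in_cons => /predU1P[->|mF] mi.
  by exists l => //; rewrite leq_max ltnSn orbT.
by have [a ak ea] := kP m mF mi; exists a => //; rewrite leq_max ak.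
Qed.

(** A new index is given a prefix long enough to separate it from the other members of [F], so the
    entry put in front of the table does not disturb the values already prescribed. *)
Lemma prefix_lookup_interpolation (F : seq I) (n : I -> nat) :
  exists s, forall i, i \in F -> prefix_lookup s i = n i.
Proof.
elim: F => [|i F [s sP]]; first by exists [::].
have [k kP] := separating_prefix i F.
exists ((mkseq (e i) k, n i) :: s) => j /=.
rewrite size_mkseq in_cons => /predU1P[->|jF]; first by rewrite eqxx.
by case: eqP => [/(kP j jF)->//|_]; exact: sP.
Qed.

End independent_family.

(** * Dual and dual ball; total and norming sequences *)

Section bounded_functionals.
Context {R : realType} {X : normedModType R}.
Implicit Types f : X -> R.

Lemma dual_bound f : dual f -> exists2 C : R, 0 < C & forall x, `|f x| <= C * `|x|.
Proof.
move=> [lf cf].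
pose F := HB.pack_for {linear X -> R^o} (f : X -> R^o)
  (GRing.isLinear.Build _ _ _ _ (f : X -> R^o) lf).
have /linear_boundedP : bounded_near F (nbhs (0 : X)).
  exact: (continuous_linear_bounded (f := F) 0 (cf 0)).
by move=> /pinfty_ex_gt0[C C0 fC]; exists C.
Qed.

Lemma dual_of_bound f (C : R) : linear (f : X -> R^o) ->
  (forall x, `|f x| <= C * `|x|) -> dual f.
Proof.
move=> lf fC; split => //.
pose F := HB.pack_for {linear X -> R^o} (f : X -> R^o)
  (GRing.isLinear.Build _ _ _ _ (f : X -> R^o) lf).
apply: (@bounded_linear_continuous _ _ _ F); apply/linear_boundedP.
exists C; split; first exact: num_real.
move=> r /ltW Cr x; apply: le_trans (fC x) _.
by rewrite ler_wpM2r.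
Qed.

Lemma dual_unit_ballP f : dual_unit_ball f <->
  linear (f : X -> R^o) /\ forall x, `|f x| <= `|x|.
Proof.
split=> [[[lf cf] fle]|[lf fle]].
  split=> // x; have [->|x0] := eqVneq x 0.
    by rewrite scalar_fun0// !normr0.
  have nx : 0 < `|x| by rewrite normr_gt0.
  (* The added 0 gives the vector the shape [a *: x + y] on which [lf] rewrites. *)
  have : `|f (`|x|^-1 *: x + 0)| <= 1.
    rewrite -lee_fin; apply: le_trans fle; apply: ereal_sup_ubound.
    exists (`|x|^-1 *: x + 0) => //=.
    by rewrite addr0 normrZ normfV normr_id mulVf// gt_eqF.
  rewrite lf scalar_fun0// addr0 normrM normfV normr_id.
  by rewrite mulrC ler_pdivrMr// mul1r.
split.
  by apply: (@dual_of_bound f 1) => // x; rewrite mul1r.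
apply: ge_ereal_sup => _ [x /= x1 <-]; rewrite lee_fin.
exact: le_trans (fle x) x1.
Qed.

Lemma dual_mid f g : dual f -> dual g -> dual (mid f g).
Proof.
move=> df dg; have [C C0 fC] := dual_bound df; have [D D0 gD] := dual_bound dg.
have [[lf _] [lg _]] := (df, dg).
apply: (@dual_of_bound _ ((C + D) / 2)) => [a x y|x].
  change (mid f g (a *: x + y) = a * mid f g x + mid f g y).
  rewrite /mid (lf a x y) (lg a x y).
  change ((a * f x + f y + (a * g x + g y)) / 2 =
    a * ((f x + g x) / 2) + (f y + g y) / 2); by field.
rewrite /mid normrM [`|2^-1|]ger0_norm//.
have := ler_normD (f x) (g x); have := fC x; have := gD x; lra.
Qed.

Lemma dual_unit_ball_mid f g :
  dual_unit_ball f -> dual_unit_ball g -> dual_unit_ball (mid f g).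
Proof.
move=> bf bg; have [[df _] [dg _]] := (bf, bg).
apply/dual_unit_ballP; split; first by have [] := dual_mid df dg.
move=> x; have [_ /(_ x) fx] := (dual_unit_ballP f).1 bf.
have [_ /(_ x) gx] := (dual_unit_ballP g).1 bg.
rewrite /mid normrM [`|2^-1|]ger0_norm//.
have := ler_normD (f x) (g x); lra.
Qed.

Lemma scale_linear (c : R) f : linear (f : X -> R^o) ->
  linear ((fun x => c * f x) : X -> R^o).
Proof.
move=> lf a x y; rewrite lf.
change (c * (a * f x + f y) = a * (c * f x) + c * f y); ring.
Qed.

(** A functional that attains [|x|] at [x], approximated there within [|x|], yields a positive
    value. Dividing by the bounds [C n] brings the sequence into the unit ball without changing
    signs. *)
Lemma total_sequence : wstar_separable_dual X ->
  exists d : nat -> X -> R,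
    [/\ (forall n, linear (d n : X -> R^o)), (forall n x, `|d n x| <= `|x|) &
        forall x, x != 0 -> exists n, 0 < d n x].
Proof.
have dual0 : dual (fun _ : X => 0 : R).
  apply: (@dual_of_bound _ 0) => [a x y|x]; last by rewrite normr0 mul0r.
  by rewrite scaler0 addr0.
move=> /(wstar_separable_sequence dual0)[d [dd dapprox]].
have /choice[C Cd] n : exists C : R, 0 < C /\ forall x, `|d n x| <= C * `|x|.
  by have [C ? ?] := dual_bound (dd n); exists C.
exists (fun n x => (C n)^-1 * d n x); split.
- by move=> n; apply: scale_linear; have [] := dd n.
- move=> n x; have [C0 Cn] := Cd n.
  by rewrite normrM gtr0_norm ?invr_gt0// mulrC ler_pdivrMr// mulrC.
- move=> x x0; have nx : 0 < `|x| by rewrite normr_gt0.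
  have [f [lf fle fx]] := hahn_banach_norm x.
  have df : dual f by apply: (@dual_of_bound f 1) => // y; rewrite mul1r.
  have [n] := dapprox f x `|x| df nx; rewrite fx ltr_norml => /andP[dx _].
  by exists n; rewrite mulr_gt0 ?invr_gt0; [|exact: (Cd n).1|lra].
Qed.

(** The error is taken relative to [|x|] so that the errors of the coordinates of an element of the
    l1-sum add up to at most [e] times its norm. *)
Lemma norming_sequence : wstar_separable_dual_unit_ball X ->
  exists d : nat -> X -> R,
    [/\ (forall n, linear (d n : X -> R^o)), (forall n x, `|d n x| <= `|x|) &
        forall x (e : R), 0 < e -> exists n, `|x| - e * `|x| <= d n x].
Proof.
have ball0 : dual_unit_ball (fun _ : X => 0 : R).
  apply/dual_unit_ballP; split=> [a x y|x]; last by rewrite normr0.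
  by rewrite scaler0 addr0.
move=> /(wstar_separable_sequence ball0)[d [dd dapprox]].
exists d; split.
- by move=> n; have [] := (dual_unit_ballP _).1 (dd n).
- by move=> n; have [] := (dual_unit_ballP _).1 (dd n).
- move=> x e e0; have [->|x0] := eqVneq x 0.
    exists 0%N; rewrite normr0 mulr0 subr0 scalar_fun0//.
    by have [] := (dual_unit_ballP _).1 (dd 0%N).
  have nx : 0 < `|x| by rewrite normr_gt0.
  have [f [lf fle fx]] := hahn_banach_norm x.
  have bf : dual_unit_ball f by exact/dual_unit_ballP.
  have [n] := dapprox f x (e * `|x|) bf (mulr_gt0 e0 nx).
  by rewrite fx ltr_norml => /andP[dx _]; exists n; lra.
Qed.

End bounded_functionals.

(** * Functionals on the l1-sum assembled from coordinate functionals *)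

Section l1_combination.
Context {R : realType} {I : choiceType} {X : I -> normedModType R}.
Variable f : forall i, nat -> X i -> R.
Hypothesis f_lin : forall i n, linear (f n : X i -> R^o).
Hypothesis f_le : forall i n (x : X i), `|f n x| <= `|x|.

Lemma l1_tail (x : l1sum X) (F0 : seq I) (e : R) : 0 < e ->
  exists F, [/\ uniq F, {subset F0 <= F} & `|x| - e < \sum_(i <- F) `|x i|].
Proof.
move=> e0.
have [F uF HF] : exists2 F, uniq F & `|x| - e < \sum_(i <- F) `|x i|.
  apply: contrapT => H.
  have : `|x| <= `|x| - e; last lra.
  rewrite {1}norm_l1E -lee_fin l1normE.
  apply: ge_ereal_sup => _ [A [finA _] <-].
  rewrite fsbig_finite//= sumEFin lee_fin leNgt; apply/negP => A_gt.
  by apply: H; exists (finmap.enum_fset (fset_set A)) => //; exact: finmap.fset_uniq.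
exists (F ++ [seq i <- undup F0 | i \notin F]); split.
- rewrite cat_uniq uF filter_uniq ?undup_uniq// andbT.
  by apply/hasPn => i; rewrite mem_filter => /andP[].
- by move=> i iF0; rewrite mem_cat mem_filter mem_undup iF0 andbT orbN.
- rewrite big_cat /=; apply: lt_le_trans HF _; rewrite lerDl.
  by apply: sumr_ge0.
Qed.

Lemma sum_norm_l1_le (x : l1sum X) (F : seq I) : uniq F ->
  \sum_(i <- F) `|x i| <= `|x|.
Proof.
move=> uF; have ux i : `|(`|x i| : R^o)| <= `|x i| by rewrite normr_id.
pose u := l1_dominated (Z := fun=> R^o) ux.
have nu : `|u| <= `|x| by exact: le_norm_l1.
have := @l1_total_approx _ _ F u u uF ux.
move=> /(le_trans (normr_ge0 _)); rewrite subr_ge0 => /le_trans; exact.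
Qed.

Definition l1_comb (phi : I -> nat) (x : l1sum X) : R :=
  l1_total (l1_dominated (Z := fun=> R^o) (fun i => f_le (phi i) (x i))).

Lemma l1_comb_linear phi : linear (l1_comb phi : l1sum X -> R^o).
Proof.
move=> a x y.
change (l1_comb phi (a *: x + y) = a * l1_comb phi x + l1_comb phi y).
rewrite /l1_comb -l1_totalZ -l1_totalD; congr l1_total.
by apply: l1sum_eq => i; exact: f_lin.
Qed.

Lemma l1_comb_le phi (x : l1sum X) : `|l1_comb phi x| <= `|x|.
Proof. by apply: le_trans (l1_total_le _) _; apply: le_norm_l1 => i; exact: f_le. Qed.

(** The coordinates outside [F] contribute at least minus the norm that they carry. *)
Lemma l1_comb_ge phi (x : l1sum X) (F : seq I) : uniq F ->
  \sum_(i <- F) f (phi i) (x i) - (`|x| - \sum_(i <- F) `|x i|) <= l1_comb phi x.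
Proof.
move=> uF; have ux i : `|(`|x i| : R^o)| <= `|x i| by rewrite normr_id.
pose u := l1_dominated (Z := fun=> R^o) ux.
have nu : `|u| <= `|x| by exact: le_norm_l1.
have := @l1_total_approx _ _ F
  (l1_dominated (Z := fun=> R^o) (fun i => f_le (phi i) (x i))) u uF
  (fun i => f_le (phi i) (x i)).
rewrite ler_distl => /andP[+ _]; rewrite /l1_comb /=; lra.
Qed.

Variable e : I -> nat -> bool.
Hypothesis e_inj : injective e.

(** The table realizes the choice [n] on a finite [F] that carries the norm of [x] up to [eps]; its
    uncontrolled values off [F] cost less than [eps]. Through [F0] a chosen coordinate can be forced
    into [F]. *)
Lemma l1_comb_interpolation (x : l1sum X) (n : I -> nat) (F0 : seq I) (eps : R) : 0 < eps ->
  exists s F, [/\ uniq F, {subset F0 <= F}, `|x| - eps < \sum_(i <- F) `|x i| &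
    \sum_(i <- F) f (n i) (x i) - eps < l1_comb (prefix_lookup e s) x].
Proof.
move=> eps0; have [F [uF F0F FP]] := l1_tail x F0 eps0.
have [s sP] := prefix_lookup_interpolation e_inj F n.
exists s, F; split => //; have := l1_comb_ge (prefix_lookup e s) x uF.
rewrite (_ : \sum_(i <- F) f _ (x i) = \sum_(i <- F) f (n i) (x i)); first lra.
by apply: eq_big_seq => i iF; rewrite sP.
Qed.

End l1_combination.

(** * Transfer of separability to the domain of the operator *)

Lemma injective_bits (I : Type) : ([set: I] #= [set: set nat])%card ->
  exists e : I -> nat -> bool, injective e.
Proof.
move=> /card_set_bijP[h [_ hinj _]]; exists (fun i k => `[< h i k >]) => i j ij.
apply: hinj; rewrite ?in_setT//; apply/seteqP; split=> k /asboolP.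
  by move/(congr1 (@^~ k)): ij => -> /asboolP.
by move/(congr1 (@^~ k)): ij => <- /asboolP.
Qed.

Theorem corollary25 (R : realType) (I : choiceType)
    (cardI : ([set: I] #= [set: set nat])%card)
    (X : I -> completeNormedModType R) (Y : completeNormedModType R) :
  ((forall i, wstar_separable_dual (X i)) ->
   (exists T : {linear Y -> l1sum X},
      injective T /\ (exists C : R, forall y : Y, `|T y| <= C * `|y|)) ->
   wstar_separable_dual Y) /\
  ((forall i, wstar_separable_dual_unit_ball (X i)) ->
   (exists T : {linear Y -> l1sum X}, forall y : Y, `|T y| = `|y|) ->
   wstar_separable_dual_unit_ball Y).
Proof.
have [e e_inj] := injective_bits cardI.
split=> [sepX [T [T_inj [C TC]]]|sepX [T T_iso]].
- pose f i := sval (cid (total_sequence (sepX i))).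
  have fP i := svalP (cid (total_sequence (sepX i))).
  have f_lin i n : linear (f i n : X i -> R^o) by have [+ _ _] := fP i; apply.
  have f_le i n (x : X i) : `|f i n x| <= `|x| by have [_ + _] := fP i; apply.
  pose G s (y : Y) : R := l1_comb f_le (prefix_lookup e s) (T y).
  have G_lin s : linear (G s : Y -> R^o).
    by move=> a x y; rewrite /G linearP l1_comb_linear.
  (* Totality gives only some [G s y > 0]. With natural multiples the values at a nonzero [y] are
     unbounded, so the support condition holds vacuously there. *)
  apply: (@separable_wstar_of_support _ _ _
    (range (fun p : nat * seq (seq bool * nat) => fun y => p.1%:R * G p.2 y))).
  + exact: sub_countable (card_image_le _ _) (countableP _).
  + by exists (fun y => 0%:R * G [::] y), (0%N, [::]).
  + move=> _ [[m s] _ <-] /=.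
    apply: (@dual_of_bound _ _ _ (m%:R * C)); first exact: scale_linear.
    move=> y; rewrite normrM ger0_norm// -mulrA ler_wpM2l//.
    exact: le_trans (l1_comb_le _ _ _) (TC y).
  + exact: dual_mid.
  + by move=> g [].
  + move=> g y b [lg _] Kb.
    have Gb m s : m%:R * G s y <= b.
      by apply: (Kb (fun y => m%:R * G s y)); exists (m, s).
    have [->|y0] := eqVneq y 0.
      by rewrite scalar_fun0//; have := Gb 0%N [::]; rewrite mul0r.
    suff [s Gs] : exists s, 0 < G s y.
      have b0 : 0 <= b by have := Gb 0%N s; rewrite mul0r.
      have := archi_boundP (divr_ge0 b0 (ltW Gs)).
      by rewrite ltr_pdivrMr// ltNge Gb.
    have [i xi] : exists i, T y i != 0.
      apply: contrapT => /forallNP H; case/eqP: y0; apply: T_inj.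
      rewrite linear0; apply: l1sum_eq => i.
      by have /negP := H i; rewrite negbK => /eqP.
    have /choice[n nP] j : exists n, T y j != 0 -> 0 < f j n (T y j).
      have [_ _ /(_ (T y j))] := fP j.
      have [->|yj] := eqVneq (T y j) 0; first by exists 0%N.
      by move=> /(_ isT)[n ?]; exists n.
    have n_ge0 j : 0 <= f j (n j) (T y j).
      have [->|/nP/ltW//] := eqVneq (T y j) 0.
      by rewrite (scalar_fun0 (f_lin j _)).
    (* The tolerance is the positive term at [i] itself. As [i] belongs to [F] and the other terms
       are nonnegative, the sum over [F] absorbs it. *)
    have [s [F [uF iF _ Gs]]] :=
      l1_comb_interpolation f_le e_inj (T y) n [:: i] (nP i xi).
    exists s; apply: le_lt_trans Gs; rewrite subr_ge0.
    rewrite (big_rem i) ?iF ?mem_head//= lerDl.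
    exact: sumr_ge0.
- pose f i := sval (cid (norming_sequence (sepX i))).
  have fP i := svalP (cid (norming_sequence (sepX i))).
  have f_lin i n : linear (f i n : X i -> R^o) by have [+ _ _] := fP i; apply.
  have f_le i n (x : X i) : `|f i n x| <= `|x| by have [_ + _] := fP i; apply.
  pose G s (y : Y) : R := l1_comb f_le (prefix_lookup e s) (T y).
  have G_lin s : linear (G s : Y -> R^o).
    by move=> a x y; rewrite /G linearP l1_comb_linear.
  apply: (@separable_wstar_of_support _ _ _ (range G)).
  + exact: sub_countable (card_image_le _ _) (countableP _).
  + by exists (G [::]), [::].
  + move=> _ [s _ <-]; apply/dual_unit_ballP; split => // y.
    by rewrite -T_iso; exact: l1_comb_le.
  + exact: dual_unit_ball_mid.
  + by move=> g /dual_unit_ballP[].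
  + move=> g y b /dual_unit_ballP[_ gle] Kb.
    apply: le_trans (ler_norm _) (le_trans (gle y) _); rewrite -T_iso.
    set x := T y; rewrite leNgt; apply/negP => bx.
    (* Three losses occur: [eps * |x|] from norming each coordinate, [eps] from the norm missed by
       [F], and [eps] from the interpolation. Their total [eps * (|x| + 2)] is exactly [|x| - b]. *)
    pose eps := (`|x| - b) / (`|x| + 2).
    have x2 : 0 < `|x| + 2 by rewrite ltr_wpDl.
    have eps0 : 0 < eps by rewrite divr_gt0// subr_gt0.
    have /choice[n nP] j : exists n, `|x j| - eps * `|x j| <= f j n (x j).
      by have [_ _ ] := fP j; apply.
    have [s [F [uF _ xF Gs]]] := l1_comb_interpolation f_le e_inj x n [::] eps0.
    have Gb : l1_comb f_le (prefix_lookup e s) x <= b by apply: (Kb (G s)); exists s.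
    have : \sum_(i <- F) `|x i| - eps * \sum_(i <- F) `|x i| <=
        \sum_(i <- F) f i (n i) (x i).
      by rewrite mulr_sumr -sumrB; exact: ler_sum.
    have epsE : eps * (`|x| + 2) = `|x| - b by rewrite divfK// gt_eqF.
    have : eps * \sum_(i <- F) `|x i| <= eps * `|x|.
      by rewrite ler_wpM2l ?sum_norm_l1_le// ltW.
    rewrite mulrDr in epsE; clearbody eps x; lra.
Qed.
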